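(* Let $\mathcal{B}$ be a real Banach space, let $\mathbb{P}$ be a kernel-based probability measure on $\mathcal{B}$ with mean $\mu\in\mathcal{B}$ and covariance kernel $\mathcal{K}:\mathcal{B}^*\times\mathcal{B}^*\to\mathbb{R}$, let $u\in\mathcal{B}$, $n\in\mathbb{N}$, $L_1,\dots,L_n\in\mathcal{B}^*$, $\mathbf{L}_n:=(L_1,\dots,L_n)^T$, $\mathbf{f}_n:=\mathbf{L}_nu\in\mathbb{R}^n$, and let $\mathcal{A}_n:=\{\omega\in\mathcal{B}:\mathbf{L}_n\omega=\mathbf{f}_n\}$. Assume $A_{\mathcal{K},\mathbf{L}_n}\neq 0$. Then for any $L\in\mathcal{B}^*$ the kernel-based estimator $s_{\mathcal{A}_n}(L)$ conditioned on $\mathcal{A}_n$ can be written as $$s_{\mathcal{A}_n}(L)=L\mu+\mathbf{b}_{\mathcal{K},\mathbf{L}_n}(L)^T A_{\mathcal{K},\mathbf{L}_n}^{\dagger}(\mathbf{f}_n-\mathbf{L}_n\mu).$$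
   Context: Write $L\omega=\langle\omega,L\rangle$ for $\omega\in\mathcal{B}$, $L\in\mathcal{B}^*$ (the dual space), and $\mathbf{L}_n\omega:=(L_1\omega,\dots,L_n\omega)^T\in\mathbb{R}^n$. A Borel probability measure $\mathbb{P}$ on $\mathcal{B}$ is a kernel-based probability measure with mean $\mu\in\mathcal{B}$ and covariance kernel $\mathcal{K}:\mathcal{B}^*\times\mathcal{B}^*\to\mathbb{R}$ if, writing $S_L(\omega):=L\omega$, for every $n$ and all $L_1,\dots,L_n\in\mathcal{B}^*$ the random vector $\mathbf{S}_{\mathbf{L}_n}:=(S_{L_1},\dots,S_{L_n})^T$ on $\mathcal{B}$ with its Borel $\sigma$-algebra and $\mathbb{P}$ has a (possibly degenerate) multivariate normal distribution with mean vector $\mathbf{L}_n\mu$ and covariance matrix $A_{\mathcal{K},\mathbf{L}_n}:=(\mathcal{K}(L_j,L_k))_{j,k=1}^{n}$. Further, $\mathbf{b}_{\mathcal{K},\mathbf{L}_n}(L):=(\mathcal{K}(L,L_1),\dots,\mathcal{K}(L,L_n))^T$ and $A^{\dagger}$ is the (Moore-Penrose) pseudo-inverse of $A$. The kernel-based estimator conditioned on a Borel set $\mathcal{A}$ is $s_{\mathcal{A}}(L):=\int_{\mathcal{B}}\langle\omega,L\rangle\,\mathbb{P}(d\omega\mid\mathcal{A})=\mathrm{E}(S_L\mid\mathcal{A})$. For $\mathcal{A}_n=\{\mathbf{S}_{\mathbf{L}_n}=\mathbf{f}_n\}$, which in general is a null set, this is understood as $\mathrm{E}(S_L\mid\mathbf{S}_{\mathbf{L}_n}=\mathbf{f}_n)$,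 the value at $\mathbf{z}=\mathbf{f}_n$ of the conditional mean function $\mathbf{z}\mapsto\mathrm{E}(S_L\mid\mathbf{S}_{\mathbf{L}_n}=\mathbf{z})$ of the jointly normal vector $(S_L,\mathbf{S}_{\mathbf{L}_n})$; thus the assertion means that $\mathbf{z}\mapsto L\mu+\mathbf{b}_{\mathcal{K},\mathbf{L}_n}(L)^TA_{\mathcal{K},\mathbf{L}_n}^{\dagger}(\mathbf{z}-\mathbf{L}_n\mu)$ is a version of this conditional mean, and $s_{\mathcal{A}_n}(L)$ is its value at $\mathbf{f}_n$. *)

(* Defs.v *)
From HB Require Import structures.
From mathcomp Require Import all_boot all_order all_algebra.
From mathcomp Require Import all_classical all_reals all_analysis.

Set Implicit Arguments.
Unset Strict Implicit.
Unset Printing Implicit Defensive.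

Import Order.TTheory GRing.Theory Num.Theory.
Import numFieldNormedType.Exports.

Local Open Scope classical_set_scope.
Local Open Scope ring_scope.

Section moore_penrose.
Variable R : realFieldType.

Definition is_mp_inverse (m n : nat) (A : 'M[R]_(m, n))
  (X : 'M[R]_(n, m)) : Prop :=
  [/\ A *m X *m A = A, X *m A *m X = X,
      (A *m X)^T = A *m X & (X *m A)^T = X *m A].

(* The default value 0 of [xget] is never used, by [mp_inverseP]. *)
Definition mp_inverse (m n : nat) (A : 'M[R]_(m, n)) : 'M[R]_(n, m) :=
  xget 0 [set X | is_mp_inverse A X].

Lemma mulmx_tr_eq0 (m n : nat) (A : 'M[R]_(m, n)) : A *m A^T = 0 -> A = 0.
Proof.
move=> A0; apply/matrixP => i j; rewrite mxE.
have /eqP := congr1 (fun M : 'M[R]_m => M i i) A0.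
rewrite !mxE (eq_bigr (fun k => A i k ^+ 2)); last first.
  by move=> k _; rewrite mxE expr2.
rewrite psumr_eq0 => [/allP/(_ j)|k _]; last exact: sqr_ge0.
by rewrite mem_index_enum /= sqrf_eq0 => /(_ isT)/eqP.
Qed.

Lemma gram_unitmx (m n : nat) (A : 'M[R]_(m, n)) :
  row_free A -> A *m A^T \in unitmx.
Proof.
move=> fA; rewrite -row_free_unit -kermx_eq0; apply/eqP.
set k := kermx _.
have k0 : k *m (A *m A^T) = 0 by exact: mulmx_ker.
have /mulmx_tr_eq0 kA0 : (k *m A) *m (k *m A)^T = 0.
  by rewrite trmx_mul !mulmxA -(mulmxA k A) k0 mul0mx.
by apply: (row_free_inj fA); rewrite kA0 mul0mx.
Qed.

Lemma is_mp_inverse_full_rank (m r n : nat) (C : 'M[R]_(m, r))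
    (D : 'M[R]_(r, n)) :
  C^T *m C \in unitmx -> D *m D^T \in unitmx ->
  is_mp_inverse (C *m D) (D^T *m invmx (D *m D^T) *m invmx (C^T *m C) *m C^T).
Proof.
move=> uC uD; set G := invmx (D *m D^T); set H := invmx (C^T *m C).
have GT : G^T = G by rewrite /G trmx_inv trmx_mul trmxK.
have HT : H^T = H by rewrite /H trmx_inv trmx_mul trmxK.
have AX : C *m D *m (D^T *m G *m H *m C^T) = C *m H *m C^T.
  by rewrite !mulmxA -(mulmxA C D) -(mulmxA C) mulmxV // mulmx1.
have XA : (D^T *m G *m H *m C^T) *m (C *m D) = D^T *m G *m D.
  by rewrite !mulmxA -(mulmxA _ C^T C) -(mulmxA _ H) mulVmx // mulmx1.
split; rewrite ?AX ?XA.
- by rewrite !mulmxA -(mulmxA _ C^T C) -(mulmxA C H) mulVmx // mulmx1.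
- by rewrite !mulmxA -(mulmxA _ D D^T) -(mulmxA D^T G) mulVmx // mulmx1.
- by rewrite !trmx_mul HT trmxK mulmxA.
- by rewrite !trmx_mul GT trmxK mulmxA.
Qed.

Lemma is_mp_inverse_ex (m n : nat) (A : 'M[R]_(m, n)) :
  exists X, is_mp_inverse A X.
Proof.
rewrite -(mulmx_base A); eexists; apply: is_mp_inverse_full_rank.
- have /gram_unitmx : row_free (col_base A)^T.
    by rewrite /row_free mxrank_tr; exact: col_base_full.
  by rewrite trmxK.
- by apply: gram_unitmx; exact: row_base_free.
Qed.

Lemma mp_inverseP (m n : nat) (A : 'M[R]_(m, n)) :
  is_mp_inverse A (mp_inverse A).
Proof.
by apply: (@xgetPex _ 0 [set X | is_mp_inverse A X]); exact: is_mp_inverse_ex.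
Qed.

Lemma is_mp_inverse_uniq (m n : nat) (A : 'M[R]_(m, n)) (X Y : 'M[R]_(n, m)) :
  is_mp_inverse A X -> is_mp_inverse A Y -> X = Y.
Proof.
move=> [AXA XAX AXt XAt] [AYA YAY AYt YAt].
have E1 : A *m X = A *m Y.
  rewrite -AYt -[in RHS]AXA -[A *m X *m A *m Y]mulmxA trmx_mul AXt AYt.
  by rewrite mulmxA AYA.
have E2 : X *m A = Y *m A.
  rewrite -XAt -[in LHS]AYA -(mulmxA A) mulmxA trmx_mul XAt YAt.
  by rewrite -mulmxA (mulmxA A) AXA.
by rewrite -XAX E2 -mulmxA E1 mulmxA YAY.
Qed.

End moore_penrose.

Definition borel (T : ptopologicalType) := g_sigma_algebraType (@open T).

(* [normal_prob m 0] is not the degenerate law, hence the case distinction. *)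
Definition normal_law {R : realType} (m s : R) (D : set R) : \bar R :=
  if s == 0 then \d_m D else normal_prob m s D.

(* Possibly degenerate N(m, Sigma), in the standard definition by which every
   linear combination t^T X has the univariate law N(t^T m, t^T Sigma t). *)
Definition mvnormal {d : measure_display} {T : measurableType d}
    {R : realType} (P : probability T R) (n : nat) (X : T -> 'cV[R]_n)
    (m : 'cV[R]_n) (Sigma : 'M[R]_n) : Prop :=
  [/\ measurable_fun setT (X : T -> borel 'cV[R]_n),
      Sigma^T = Sigma,
      forall t : 'cV[R]_n, 0 <= (t^T *m Sigma *m t) 0 0 &
      forall (t : 'cV[R]_n) (D : set R), measurable D ->
        P [set w | D ((t^T *m X w) 0 0)] =
        normal_law ((t^T *m m) 0 0) (Num.sqrt ((t^T *m Sigma *m t) 0 0)) D].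

(* [g] is a version of the conditional mean function z |-> E(Y | X = z). *)
Definition cond_mean_version {d : measure_display} {T : measurableType d}
    {R : realType} (P : probability T R) (n : nat) (Y : T -> R)
    (X : T -> 'cV[R]_n) (g : 'cV[R]_n -> R) : Prop :=
  [/\ P.-integrable setT (fun w => (Y w)%:E),
      measurable_fun setT (g : borel 'cV[R]_n -> R),
      P.-integrable setT (fun w => (g (X w))%:E) &
      forall D : set (borel 'cV[R]_n), measurable D ->
        (\int[P]_(w in X @^-1` D) (Y w)%:E =
         \int[P]_(w in X @^-1` D) (g (X w))%:E)%E].

Section kernel_based.
Variables (R : realType) (B : completeNormedModType R).

Record dual := Dual {
  dual_fun : {linear B -> R^o};
  dual_continuous : continuous dual_fun }.

Definition pairing (w : B) (L : dual) : R := dual_fun L w.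

Definition S_ (L : dual) (w : borel B) : R := pairing w L.

Definition Lvec (n : nat) (Ls : 'I_n -> dual) (w : B) : 'cV[R]_n :=
  \col_i pairing w (Ls i).

Definition cov_mx (K : dual -> dual -> R) (n : nat) (Ls : 'I_n -> dual) :
  'M[R]_n := \matrix_(j, k) K (Ls j) (Ls k).

Definition cov_vec (K : dual -> dual -> R) (n : nat) (Ls : 'I_n -> dual)
  (L : dual) : 'cV[R]_n := \col_j K L (Ls j).

Definition kernel_based (P : probability (borel B) R) (mu : B)
    (K : dual -> dual -> R) : Prop :=
  forall (n : nat) (Ls : 'I_n -> dual),
    mvnormal P (Lvec Ls) (Lvec Ls mu) (cov_mx K Ls).

(* s_A(L), the mean of L under P( . | A), for a Borel set A of positive
   probability: the integral of L over A divided by P(A). *)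
Definition cond_estimator (P : probability (borel B) R) (A : set (borel B))
  (L : dual) : R := Rintegral P A (S_ L) / fine (P A).

End kernel_based.

(* Main.v *)
From HB Require Import structures.
Require Import Defs.
From mathcomp Require Import all_boot all_order all_algebra.
From mathcomp Require Import all_classical all_reals all_analysis.
From mathcomp Require Import measurable_realfun.
From mathcomp Require Import ring lra.

Set Implicit Arguments.
Unset Strict Implicit.
Unset Printing Implicit Defensive.

Import Order.TTheory GRing.Theory Num.Theory.
Import numFieldNormedType.Exports.

Local Open Scope classical_set_scope.
Local Open Scope ring_scope.

(** Put [Y = L], [X = (L_1, ..., L_n)] and let [b], [A] be the cross covariance
    and the covariance matrix.  The candidate [g(z) = E Y + b^T A^+ (z - E X)] is
    a version of the conditional mean as soon as the residual [Z = Y - g(X)]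
    integrates to zero over every event [X \in D].

    The residual is uncorrelated with [X]: positive semidefiniteness of the joint
    covariance makes [b] orthogonal to the kernel of [A], so [b^T A^+ A = b^T]
    ([psd_cross_covariance_mp]).  Hence [a Z + t^T X] is normal with mean
    [t^T E X] and a variance that depends on [a] only through [a ^+ 2]; it has
    the same law as [- a Z + t^T X].  This symmetry stands in for independence
    of [Z] and [X], and it makes characteristic functions superfluous:
    integrating the cosine against both laws gives
    [E (sin (a Z) * sin (t^T X + c)) = 0], and dividing by [a] and letting [a]
    tend to 0 gives [E (Z * sin (t^T X + c)) = 0] for all [t] and [c]
    ([trig_orth_symmetric_law]).

    It remains to pass from sine waves to indicators of Borel sets
    ([trig_orth_integral_eq0]).  Consider the bounded measurable functions of
    the sample point such that multiplying by them preserves orthogonality to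
    all the waves [sin (t^T X + c)].  They form an algebra closed under bounded pointwise
    limits, and by the product-to-sum formula they contain the waves themselves.
    A polynomial iteration turns a wave into its sign, and stretching the wave
    turns that into the indicator of a half-space.  The sets whose indicators
    are such multipliers form a sigma-algebra, so they include all Borel sets.

    The value of the version at a point [z] with [P (X = z) > 0] is the
    elementary conditional mean, because [g(X)] is constant on that event. *)

(** * Limits under the integral sign *)

Section bounded_multiples.
Context {d : measure_display} {T : measurableType d} {R : realType}.
Context (P : {measure set T -> \bar R}).
Implicit Types (W f : T -> R).

Lemma integrable_mul_bounded W f (M : R) :
  P.-integrable setT (EFin \o W) -> measurable_fun setT f ->
  (forall w, `|f w| <= M) -> P.-integrable setT (EFin \o (fun w => W w * f w)).
Proof.
move=> iW mf fM.
have mW : measurable_fun setT W by exact/measurable_EFinP/(measurable_int P).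
apply: (@le_integrable _ _ _ P setT measurableT _
  (fun w => M%:E * `|(W w)%:E|)%E).
- by apply/measurable_EFinP; exact: measurable_funM.
- move=> w _ /=; rewrite lee_fin !normrM mulrC normr_id.
  by rewrite ler_wpM2r// (le_trans (fM w))// ler_norm.
- by apply: integrableZl => //; exact: integrable_abse.
Qed.

Lemma cvg_Rintegral_dominated (f_ : nat -> T -> R) f (g : T -> R) :
  (forall k, measurable_fun setT (f_ k)) -> P.-integrable setT (EFin \o g) ->
  (forall k w, `|f_ k w| <= g w) -> (forall w, f_ k w @[k --> \oo] --> f w) ->
  Rintegral P setT (f_ k) @[k --> \oo] --> Rintegral P setT f.
Proof.
move=> mf ig fg ff.
have mlf : measurable_fun setT f.
  by apply: (measurable_fun_cvg mf) => w _; exact: ff.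
have [|||||i1 _ i2] := @dominated_convergence _ _ _ P setT measurableT
  (fun k w => (f_ k w)%:E) (fun w => (f w)%:E) (EFin \o g).
- by move=> k; exact/measurable_EFinP.
- exact/measurable_EFinP.
- by apply: aeW => w _; apply: cvg_EFin; [exact: nearW|exact: ff].
- exact: ig.
- by apply: aeW => w k _; rewrite lee_fin.
apply: fine_cvg.
rewrite fineK; first exact: i2.
exact: integrable_fin_num.
Qed.

Lemma cvg_Rintegral_mul_bounded W (f_ : nat -> T -> R) f (M : R) :
  P.-integrable setT (EFin \o W) -> (forall k, measurable_fun setT (f_ k)) ->
  (forall k w, `|f_ k w| <= M) -> (forall w, f_ k w @[k --> \oo] --> f w) ->
  Rintegral P setT (fun w => W w * f_ k w) @[k --> \oo] -->
  Rintegral P setT (fun w => W w * f w).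
Proof.
move=> iW mf fM ff.
have mW : measurable_fun setT W by exact/measurable_EFinP/(measurable_int P).
apply: (@cvg_Rintegral_dominated _ _ (fun w => `|W w| * M)).
- by move=> k; exact: measurable_funM.
- exact: (@integrable_mul_bounded (fun w => `|W w|) (fun=> M) `|M|
    (integrable_norm iW)).
- by move=> k w; rewrite normrM ler_wpM2l.
- by move=> w; apply: cvgMl_tmp; exact: ff.
Qed.

End bounded_multiples.

(** * The sign function as a limit of polynomials *)

Section newton_schulz.
Context {R : realType}.
Implicit Types x : R.

(** The Newton-Schulz step for the matrix sign function, in dimension one: a
    polynomial that maps the interval from -1 to 1 to itself and whose iterates
    converge to the sign of the starting point. *)
Definition sgn_step x : R := (3 * x - x ^+ 3) / 2.

Lemma iter_sgn_stepN k x : iter k sgn_step (- x) = - iter k sgn_step x.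
Proof. by elim: k => //= k ->; rewrite /sgn_step; ring. Qed.

Lemma norm_iter_sgn_step k x : `|x| <= 1 -> `|iter k sgn_step x| <= 1.
Proof.
move=> x1; elim: k => //= k; set y := iter _ _ _;
  rewrite !ler_norml => /andP[y0 y1].
(* The numerators of [1 - sgn_step y] and [1 + sgn_step y]. *)
have H : 0 <= (1 - y) ^+ 2 * (2 + y) by rewrite mulr_ge0 ?sqr_ge0//; lra.
have H' : 0 <= (1 + y) ^+ 2 * (2 - y) by rewrite mulr_ge0 ?sqr_ge0//; lra.
by rewrite /sgn_step; apply/andP; split; lra.
Qed.

(** One step multiplies the distance to 1 by [(1 - y) * (2 + y) / 2], which is
    at most [1 - x / 2] as long as the iterate [y] stays above [x]. *)
Lemma iter_sgn_step_ge k x : 0 < x <= 1 ->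
  x <= iter k sgn_step x /\ 1 - (1 - x / 2) ^+ k <= iter k sgn_step x <= 1.
Proof.
move=> /andP[x0 x1]; elim: k => [|k /=]; first by rewrite expr0/= subrr; lra.
set y := iter _ _ _; rewrite exprS; set q := _ ^+ k.
have q0 : 0 <= q by rewrite exprn_ge0//; lra.
move=> [xy /andP[qy y1]]; rewrite /sgn_step.
have y0 : 0 < y := lt_le_trans x0 xy.
have H : 1 - (3 * y - y ^+ 3) / 2 = (1 - y) * ((1 - y) * (2 + y) / 2) by field.
have H1 : 0 <= (1 - y) * (2 + y) / 2 by rewrite divr_ge0 ?mulr_ge0//; lra.
have H2 : (1 - y) * (2 + y) / 2 <= 1 - x / 2 by nra.
split.
  have : 0 <= y * ((1 - y) * (1 + y)) by rewrite !mulr_ge0//; lra.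
  by lra.
apply/andP; split; last first.
  by rewrite -subr_ge0 H mulr_ge0// subr_ge0.
rewrite lerBlDr -lerBlDl H (le_trans (ler_wpM2l _ H2)) ?subr_ge0// mulrC.
by rewrite ler_wpM2l//; lra.
Qed.

Lemma cvg_iter_sgn_step x : `|x| <= 1 ->
  iter k sgn_step x @[k --> \oo] --> Num.sg x.
Proof.
have pos y : 0 < y <= 1 -> iter k sgn_step y @[k --> \oo] --> (1 : R).
  move=> y01; have /andP[y0 y1] := y01.
  apply: (@squeeze_cvgr _ _ _ _ (fun k => 1 - (1 - y / 2) ^+ k) (fun=> 1)).
  - by near=> k; have [_ ->] := iter_sgn_step_ge k y01.
  - rewrite -[X in _ --> X]subr0; apply: cvgB; first exact: cvg_cst.
    by apply: cvg_expr; rewrite ltr_norml; apply/andP; split; lra.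
  - exact: cvg_cst.
rewrite ler_norml => /andP[xN1 x1]; have [x0|x0|->] := ltgtP x 0.
- rewrite ltr0_sg// -[x]opprK; under eq_fun do rewrite iter_sgn_stepN.
  by apply: cvgN; apply: pos; apply/andP; split; lra.
- by rewrite gtr0_sg//; apply: pos; rewrite x0.
- rewrite sgr0 (_ : (fun k => _) = fun=> 0); first exact: cvg_cst.
  by apply/funext; elim=> //= k ->; rewrite /sgn_step; field.
Unshelve. all: by end_near. Qed.

Lemma sg_sin x : `|x| < 2 -> Num.sg (sin x) = Num.sg x.
Proof.
rewrite ltr_norml => /andP[x2 x2']; have [x0|x0|->] := ltgtP x 0.
- have y0 : 0 < - x by lra.
  rewrite -[x]opprK sinN 2!sgrN (gtr0_sg y0) gtr0_sg//.
  by apply: sin2_gt0; apply/andP; split; lra.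
- by rewrite !gtr0_sg//; apply: sin2_gt0; rewrite x0.
- by rewrite sin0.
Qed.

Lemma cvg_sg_sin_div x :
  Num.sg (sin (k.+1%:R^-1 * x)) @[k --> \oo] --> Num.sg x.
Proof.
apply: cvg_near_cst; near=> k.
have k0 : 0 < k.+1%:R^-1 :> R by rewrite invr_gt0 ltr0n.
rewrite sg_sin; first by rewrite sgrM gtr0_sg ?mul1r.
rewrite normrM gtr0_norm// mulrC ltr_pdivrMr ?ltr0n//.
have := ltr0Sn R k; suff : `|x| < k.+1%:R by lra.
rewrite -natr1; have : `|x| <= k%:R; last lra.
by near: k; exact: nbhs_infty_ger.
Unshelve. all: by end_near. Qed.

End newton_schulz.

(** * Multipliers of the functions orthogonal to all sine waves *)

Section trigonometric_multipliers.
Context {d : measure_display} {T : measurableType d} {R : realType}.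
Context (P : {measure set T -> \bar R}) (n : nat) (X : T -> 'cV[R]_n).
Implicit Types (W f g : T -> R) (t : 'cV[R]_n) (c : R).

Definition affine t c (y : 'cV[R]_n) : R := (t^T *m y) 0 0 + c.

(** The phase [c] ranges over all reals, so cosines are included; this is the
    vanishing of the Fourier transform of the signed measure with density [W],
    carried to the range of [X]. *)
Definition trig_orth W : Prop :=
  P.-integrable setT (EFin \o W) /\
  forall t c, Rintegral P setT (fun w => W w * sin (affine t c (X w))) = 0.

(** The test function [W] is quantified inside, so that closure under products
    is mere composition and iterated limits can be taken one at a time. *)
Definition multiplier f : Prop :=
  [/\ measurable_fun setT f, exists M, forall w, `|f w| <= M &
      forall W, trig_orth W -> trig_orth (fun w => W w * f w)].

Context (mX : forall t c, measurable_fun setT (fun w => affine t c (X w))).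

Let msin t c : measurable_fun setT (fun w => sin (affine t c (X w))).
Proof.
by apply: measurableT_comp => //; apply: continuous_measurable_fun;
  exact: continuous_sin.
Qed.

Let integrable_mul_sin W t c : P.-integrable setT (EFin \o W) ->
  P.-integrable setT (EFin \o (fun w => W w * sin (affine t c (X w)))).
Proof.
by move=> iW; apply: (integrable_mul_bounded iW) => // w; exact: sin_max.
Qed.

Lemma multiplier_cst r : multiplier (fun=> r).
Proof.
split; [exact: measurable_cst|by exists `|r| |move=> W [iW W0]].
split=> [|t c]; first exact: (@integrable_mul_bounded _ _ _ P W (fun=> r) `|r|).
under eq_Rintegral do rewrite mulrAC.
by rewrite RintegralZr ?W0 ?mul0r//; exact: integrable_mul_sin.
Qed.

Lemma multiplierM f g :
  multiplier f -> multiplier g -> multiplier (fun w => f w * g w).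
Proof.
move=> [mf [Mf fM] Hf] [mg [Mg gM] Hg]; split; first exact: measurable_funM.
  by exists (Mf * Mg) => w; rewrite normrM ler_pM.
by move=> W /Hf/Hg; under [X in trig_orth X]eq_fun do rewrite -mulrA.
Qed.

Lemma multiplierD f g :
  multiplier f -> multiplier g -> multiplier (fun w => f w + g w).
Proof.
move=> [mf [Mf fM] Hf] [mg [Mg gM] Hg]; split; first exact: measurable_funD.
  by exists (Mf + Mg) => w; rewrite (le_trans (ler_normD _ _))// lerD.
move=> W Wo; have [iWf Wf0] := Hf _ Wo; have [iWg Wg0] := Hg _ Wo; split.
  apply: eq_integrable (integrableD measurableT iWf iWg) => // w _.
  by rewrite /= mulrDr.
move=> t c; under eq_Rintegral do rewrite mulrDr mulrDl.
rewrite RintegralD//; [|exact: integrable_mul_sin..].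
by rewrite Wf0 Wg0 addr0.
Qed.

Lemma multiplier_cvg (M : R) (f_ : nat -> T -> R) f :
  (forall k, multiplier (f_ k)) -> (forall k w, `|f_ k w| <= M) ->
  (forall w, f_ k w @[k --> \oo] --> f w) -> multiplier f.
Proof.
move=> mf_ fM ff; have mf k : measurable_fun setT (f_ k) by case: (mf_ k).
have mlf : measurable_fun setT f.
  by apply: (measurable_fun_cvg mf) => w _; exact: ff.
have fM' w : `|f w| <= M.
  have /cvg_norm h := ff w; rewrite -(cvg_lim _ h)//.
  by apply: limr_le; [exact: cvgP h | exact: nearW].
split => //; first by exists M.
move=> W Wo; have [iW _] := Wo; split;
  first exact: integrable_mul_bounded iW mlf fM'.
move=> t c; have :=
  cvg_Rintegral_mul_bounded (integrable_mul_sin t c iW) mf fM ff.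
under eq_fun do under eq_Rintegral do rewrite mulrAC.
under [in X in _ --> X -> _]eq_Rintegral do rewrite mulrAC.
rewrite (_ : (fun k => _) = fun=> 0) => [h|]; last first.
  by apply/funext => k; have [_ _ /(_ _ Wo)[_ ->]] := mf_ k.
by rewrite -(cvg_lim _ h)// lim_cst.
Qed.

(** The product of two waves is a combination of two waves, by the
    product-to-sum formula. *)
Lemma multiplier_sin t c : multiplier (fun w => sin (affine t c (X w))).
Proof.
split=> //; first by exists 1 => w; exact: sin_max.
move=> W [iW W0]; split; first exact: integrable_mul_sin.
move=> t' c'.
have E w : W w * sin (affine t c (X w)) * sin (affine t' c' (X w)) =
  2^-1 * (W w * sin (affine (t - t') (c - c' + pi / 2) (X w)) -
          W w * sin (affine (t + t') (c + c' + pi / 2) (X w))).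
  have -> : affine (t - t') (c - c' + pi / 2) (X w) =
    affine t c (X w) - affine t' c' (X w) + pi / 2.
    by rewrite /affine raddfB mulmxBl !mxE; ring.
  have -> : affine (t + t') (c + c' + pi / 2) (X w) =
    affine t c (X w) + affine t' c' (X w) + pi / 2.
    by rewrite /affine raddfD mulmxDl !mxE; ring.
  by rewrite !sinDpihalf cosB cosD; field.
under eq_Rintegral do rewrite E.
rewrite RintegralZl//; last first.
  exact: (integrableB measurableT (integrable_mul_sin _ _ iW)
    (integrable_mul_sin _ _ iW)).
rewrite RintegralB//; [|exact: integrable_mul_sin..].
by rewrite !W0 subrr mulr0.
Qed.

Lemma multiplier_sg f : (forall w, `|f w| <= 1) ->
  multiplier f -> multiplier (fun w => Num.sg (f w)).
Proof.
move=> f1 mf; apply: (@multiplier_cvg 1 (fun k w => iter k sgn_step (f w))).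
- elim=> //= k IH; rewrite /sgn_step.
  rewrite (_ : (fun w => _) = fun w => 3 / 2 * iter k sgn_step (f w) +
     (- 2^-1) * (iter k sgn_step (f w) *
       (iter k sgn_step (f w) * iter k sgn_step (f w)))).
    by apply: multiplierD; apply: multiplierM;
      (try exact: multiplier_cst) => //; do !apply: multiplierM.
  by apply/funext => w; rewrite /sgn_step; field.
- by move=> k w; exact: norm_iter_sgn_step.
- by move=> w; exact: cvg_iter_sgn_step.
Qed.

(** The wave of frequency [1 / k.+1] has the sign of its argument on a window
    that grows with [k]. *)
Lemma multiplier_sg_affine t c :
  multiplier (fun w => Num.sg (affine t c (X w))).
Proof.
apply: (@multiplier_cvg 1
  (fun k w => Num.sg (sin (k.+1%:R^-1 * affine t c (X w))))).
- move=> k; apply: multiplier_sg => [w|]; first exact: sin_max.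
  have := multiplier_sin (k.+1%:R^-1 *: t) (k.+1%:R^-1 * c).
  congr multiplier; apply/funext => w; congr sin.
  by rewrite /affine linearZ/= -scalemxAl mxE mulrDr.
- by move=> k w; rewrite normr_sg lern1 leq_b1.
- by move=> w; exact: cvg_sg_sin_div.
Qed.

Definition halfspace t c : set 'cV[R]_n := [set y | 0 < affine t c y].

Definition multiplier_set (D : set 'cV[R]_n) : Prop :=
  multiplier (fun w => \1_D (X w)).

Lemma multiplier_halfspace t c : multiplier_set (halfspace t c).
Proof.
(* The indicator of [x > 0] is [(sg x + sg x * sg x) / 2]. *)
have ms := multiplier_sg_affine t c.
have := multiplierM (multiplier_cst 2^-1) (multiplierD ms (multiplierM ms ms)).
congr multiplier; apply/funext => w; rewrite indicE.
have [x0|x0|x0] := ltgtP (affine t c (X w)) 0.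
- rewrite memNset ?ltr0_sg//=; first by field.
  by rewrite /halfspace/= ltNge ltW.
- by rewrite mem_set// gtr0_sg//=; field.
- by rewrite memNset ?x0 ?sgr0//=; [field|rewrite /halfspace/= x0 ltxx].
Qed.

Lemma multiplier_setC D : multiplier_set D -> multiplier_set (~` D).
Proof.
move=> mD.
have := multiplierD (multiplier_cst 1) (multiplierM (multiplier_cst (-1)) mD).
by congr multiplier; apply/funext => w; rewrite !indicE in_setC;
  case: (_ \in _) => /=; ring.
Qed.

Lemma multiplier_setU D D' :
  multiplier_set D -> multiplier_set D' -> multiplier_set (D `|` D').
Proof.
move=> mD mD'; have := multiplierD (multiplierD mD mD')
  (multiplierM (multiplier_cst (-1)) (multiplierM mD mD')).
congr multiplier; apply/funext => w; rewrite !indicE in_setU.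
by case: (_ \in _); case: (_ \in _) => /=; ring.
Qed.

Lemma multiplier_set_sigma_algebra : sigma_algebra setT multiplier_set.
Proof.
have m0 : multiplier_set set0.
  by have := multiplier_cst 0; congr multiplier; apply/funext => w;
    rewrite indic0.
split=> // [D mD|D_ mD]; first by rewrite setTD; exact: multiplier_setC.
apply: (@multiplier_cvg 1 (fun k w => \1_(\big[setU/set0]_(i < k) D_ i) (X w))).
- elim=> [|k IH]; first by rewrite big_ord0.
  by rewrite big_ord_recr; exact: multiplier_setU.
- by move=> k w; rewrite indicE normr_nat lern1 leq_b1.
- move=> w; rewrite indicE; case: (pselect ((\bigcup_i D_ i) (X w))) =>
    [[i _ Di]|Dw].
    rewrite mem_set; last by exists i.
    apply: cvg_near_cst; near=> k; rewrite indicE mem_set//.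
    rewrite -bigcup_mkord; exists i => //=.
    by near: k; exact: nbhs_infty_gt.
  rewrite memNset//; apply: cvg_near_cst; apply: nearW => k.
  rewrite indicE memNset// => Dw'; apply: Dw.
  by move: Dw'; rewrite -bigcup_mkord => -[i _ Di]; exists i.
Unshelve. all: by end_near. Qed.

End trigonometric_multipliers.

(** * Borel sets of the column vectors are generated by half-spaces *)

Section borel_halfspaces.
Context {R : realType} (n : nat).

Let Gen : set (set 'cV[R]_n) := [set D | exists t c, D = halfspace t c].
Let TG := g_sigma_algebraType Gen.

Let box (q : 'cV[R]_n) (e : R) : set TG :=
  [set y : 'cV[R]_n | forall i, `|q i 0 - y i 0| < e].

Let affine_delta (i : 'I_n) c (y : 'cV[R]_n) :
  affine (delta_mx i 0) c y = y i 0 + c.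
Proof. by rewrite /affine trmx_delta -rowE mxE. Qed.

Let measurable_box q e : measurable (box q e).
Proof.
have -> : box q e = \bigcap_(i in [set: 'I_n])
    ((halfspace (delta_mx i 0) (e - q i 0) : set TG) `&`
     (halfspace (- delta_mx i 0) (e + q i 0) : set TG)).
  have NE (i : 'I_n) c (y : 'cV[R]_n) :
      affine (- delta_mx i 0) c y = - y i 0 + c.
    by rewrite /affine raddfN /= trmx_delta mulNmx -rowE !mxE.
  apply/seteqP; split => y /=.
    move=> qy i _; have := qy i; rewrite ltr_norml => /andP[q1 q2].
    by split; rewrite /halfspace/= ?affine_delta ?NE; lra.
  move=> qy i; have [] := qy i I; rewrite /halfspace/= affine_delta NE => q1 q2.
  by rewrite ltr_norml; apply/andP; split; lra.
apply: fin_bigcap_measurable; first exact: finite_finset.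
move=> i _; apply: measurableI; apply: sub_sigma_algebra;
  by do 2 eexists.
Qed.

(** An open set is the union of the countably many boxes with rational center
    and radius [1 / N.+1] that it contains, and a box is an intersection of
    finitely many half-spaces. *)
Lemma borel_sigma_halfspace (D : set (borel 'cV[R]_n)) :
  measurable D -> <<s Gen >> D.
Proof.
apply: smallest_sub; first exact: smallest_sigma_algebra.
move=> U oU.
pose A (k : nat) : set TG :=
  if (unpickle k : option ('cV[rat]_n * nat)) is Some (q, N)
  then if `[< box (map_mx ratr q) N.+1%:R^-1 `<=` U >]
       then box (map_mx ratr q) N.+1%:R^-1 else set0
  else set0.
have -> : U = \bigcup_k A k.
  apply/seteqP; split => [y Uy|y [k _]]; last first.
    rewrite /A; case: unpickle => [[q N]|//].
    by case: asboolP => // + ?; exact.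
  have /nbhs_ballP[e /= e0 yeU] : nbhs y U by exact: open_nbhs_nbhs.
  have [N Ne] : exists N : nat, N.+1%:R^-1 < e / 2.
    by exists (Num.truncn (e / 2)^-1);
      rewrite invf_plt ?posrE ?divr_gt0 ?ltr0n// truncnS_gt.
  have N0 : 0 < N.+1%:R^-1 :> R by rewrite invr_gt0 ltr0n.
  have /choice[q qy] : forall i : 'I_n, exists r : rat,
      `|ratr r - y i 0| < N.+1%:R^-1.
    move=> i; have [|r /itvP yr] :=
      @rat_in_itvoo R (y i 0 - N.+1%:R^-1) (y i 0 + N.+1%:R^-1).
      by rewrite ltrBlDr -addrA ltrDl addr_gt0.
    exists r; rewrite ltr_norml; apply/andP; split.
      by rewrite ltrBrDl yr.
    by rewrite ltrBlDl yr.
  have Bq i : (map_mx ratr (\col_i q i)) i 0 = ratr (q i) :> R by rewrite !mxE.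
  exists (pickle (\col_i q i, N)) => //; rewrite /A pickleK.
  case: asboolP => [_ i|]; first by rewrite Bq.
  case; move=> z zq; apply: yeU; split => // i j.
  rewrite ord1 /ball/=; have := zq i; rewrite Bq; move: Ne (qy i).
  move: (N.+1%:R^-1 : R) => u; rewrite !ltr_norml => ? /andP[? ?] /andP[? ?].
  by apply/andP; split; lra.
apply: (@bigcupT_measurable _ TG) => k; rewrite /A.
by case: unpickle => [[q N]|//]; case: ifP => // _; exact: measurable_box.
Qed.

End borel_halfspaces.

(** * Orthogonality to sine waves determines the conditional mean *)

Section uniqueness.
Context {d : measure_display} {T : measurableType d} {R : realType}.
Context (P : {measure set T -> \bar R}) (n : nat) (X : T -> 'cV[R]_n).

(** A form of the injectivity of the Fourier transform: the indicator of [D] is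
    a multiplier, and the product of [W] with it is tested against the constant
    wave. *)
Lemma trig_orth_integral_eq0 (W : T -> R) (D : set (borel 'cV[R]_n)) :
  measurable_fun setT (X : T -> borel 'cV[R]_n) ->
  (forall t c, measurable_fun setT (fun w => affine t c (X w))) ->
  trig_orth P X W -> measurable D ->
  (\int[P]_(w in X @^-1` D) (W w)%:E = 0)%E.
Proof.
move=> mX mA Wo mD.
have mXD : measurable (X @^-1` D) by rewrite -[X @^-1` D]setTI; exact: mX.
(* Frequency 0 and phase [pi / 2] give the constant 1. *)
have [_ _ /(_ _ Wo)[iW /(_ 0 (pi / 2))]] : multiplier_set P X D.
  apply: (smallest_sub _ _ (borel_sigma_halfspace mD)).
    exact: multiplier_set_sigma_algebra.
  by move=> _ [t [c ->]]; exact: multiplier_halfspace.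
rewrite integral_mkcond => h.
rewrite -[LHS]fineK; last first.
  apply: integrable_fin_num => //; rewrite -integrable_mkcond//.
  by apply: (integrableS measurableT) => //; exact: (proj1 Wo).
congr EFin; rewrite -[RHS]h; congr fine; apply: eq_integral => w _.
rewrite /affine trmx0 mul0mx mxE add0r sin_pihalf mulr1 patchE indicE.
rewrite (_ : (w \in X @^-1` D) = (X w \in D)); last first.
  by apply/idP/idP; rewrite !inE.
by case: (_ \in D); rewrite ?mulr1 ?mulr0.
Qed.

End uniqueness.

(** * Univariate normal laws *)

Section normal_law_facts.
Context {R : realType}.
Local Notation mu := (@lebesgue_measure R).

Let measurable_shift (a : R) :
  measurable_fun setT (fun x : measurableTypeR R => x + a : measurableTypeR R).
Proof. exact: measurable_funD. Qed.

(** Bundled, because an image measure is a measure only for a measurable map. *)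
Let shift_mfun (a : R) : {mfun measurableTypeR R >-> measurableTypeR R} :=
  HB.pack (fun x : measurableTypeR R => x + a : measurableTypeR R)
    (isMeasurableFun.Build _ _ _ _ _ (@measurable_shift a)).

Lemma lebesgue_measure_shift (a : R) (D : set R) : measurable D ->
  mu ((fun x => x + a) @^-1` D) = mu D.
Proof.
move=> mD; apply/esym.
apply: (@lebesgue_measure_unique R (pushforward mu (shift_mfun a))) => //.
move=> _ [[x y]] _ <-; rewrite /= /pushforward.
rewrite (_ : _ @^-1` _ = `]x - a, y - a]%classic); last first.
  by apply/seteqP; split => z /=; rewrite !in_itv/= ltrBlDr lerBrDr.
by rewrite !lebesgue_measure_itv/= !lte_fin ltrD2r; case: ifP => // _;
  congr EFin; ring.
Qed.

Lemma normal_pdf_shift (m s a x : R) : s != 0 ->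
  normal_pdf (m + a) s (x + a) = normal_pdf m s x.
Proof.
move=> s0; rewrite !normal_pdfE// /normal_fun.
by rewrite (_ : x + a - (m + a) = x - m)//; ring.
Qed.

Lemma normal_law_shift (m s a : R) (D : set R) : measurable D ->
  normal_law m s ((fun x => x + a) @^-1` D) = normal_law (m + a) s D.
Proof.
move=> mD; rewrite /normal_law; case: ifPn => [_|s0]; first by rewrite !diracE.
rewrite /normal_prob.
rewrite [RHS](eq_measure_integral (pushforward mu (shift_mfun a))); last first.
  by move=> A mA _; rewrite /= /pushforward lebesgue_measure_shift.
rewrite ge0_integral_pushforward//=.
- by apply: eq_integral => x _; congr EFin; exact/esym/normal_pdf_shift.
- by apply/measurable_EFinP; apply: measurable_funTS;
    exact: measurable_normal_pdf.
- by move=> x _; rewrite lee_fin normal_pdf_ge0.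
Qed.

(** The density agrees almost everywhere with the Radon-Nikodym derivative, for
    which the change of measure is known for all nonnegative functions. *)
Lemma ge0_integral_normal_prob (m s : R) (f : R -> \bar R) :
  measurable_fun setT f -> (forall x, 0 <= f x)%E ->
  (\int[normal_prob m s]_x f x = \int[mu]_x (f x * (normal_pdf m s x)%:E))%E.
Proof.
move=> mf f0.
have dom := @normal_prob_dominates R m s.
rewrite -(Radon_Nikodym_SigmaFinite.change_of_variables dom)//.
have iRN := Radon_Nikodym_SigmaFinite.f_integrable dom.
apply: ae_eq_integral => //.
- by apply: emeasurable_funM => //; exact: (measurable_int mu).
- by apply: emeasurable_funM => //; apply/measurable_EFinP;
    exact: measurable_normal_pdf.
- apply: ae_eqe_mul2l => /=.
  apply: integral_ae_eq => //.
  + by apply/measurable_EFinP; exact: measurable_normal_pdf.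
  + by move=> E _ mE; rewrite -Radon_Nikodym_SigmaFinite.f_integral.
Qed.

(** With [y = |x - m| / |s|], the inequality
    [y <= 1 + y ^+ 2 / 4 <= expR (y ^+ 2 / 4)] absorbs the factor [|x|] into a
    normal density of doubled variance. *)
Lemma normal_prob_first_moment (m s : R) : s != 0 ->
  (\int[normal_prob m s]_x `|x%:E| < +oo)%E.
Proof.
move=> s0; rewrite ge0_integral_normal_prob//; last exact: measurableT_comp.
set s' := Num.sqrt 2 * s.
have s'0 : s' != 0 by rewrite mulf_neq0// sqrtr_eq0 -ltNge.
have s'2 : s' ^+ 2 = 2 * s ^+ 2 by rewrite exprMn sqr_sqrtr.
have p'0 := normal_peak_gt0 s'0.
pose C := (`|m| + `|s|) * normal_peak s / normal_peak s'.
apply: (@le_lt_trans _ _ (\int[mu]_x (C%:E * (normal_pdf m s' x)%:E))%E);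
  last first.
  rewrite integralZl//; last exact: integrable_normal_pdf.
  by rewrite integral_normal_pdf mule1 ltry.
apply: ge0_le_integral => //=.
- by move=> x _; rewrite mule_ge0// lee_fin normal_pdf_ge0.
- apply/measurable_EFinP; apply: measurable_funM;
    last exact: measurable_normal_pdf.
  exact: normr_measurable.
- by apply/measurable_EFinP; apply: measurable_funM => //;
    exact: measurable_normal_pdf.
move=> x _; rewrite lee_fin !normal_pdfE// /C.
set y := `|x - m| / `|s|.
have y2 : y ^+ 2 = (x - m) ^+ 2 / s ^+ 2.
  by rewrite expr_div_n !real_normK ?num_real.
have xle : `|x| <= (`|m| + `|s|) * expR (y ^+ 2 / 4).
  have h : `|x| <= `|m| + `|s| * y.
    rewrite /y mulrC divfK ?normr_eq0// -lerBlDl.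
    by rewrite (le_trans _ (lerB_dist _ _)).
  have e1 : 1 + y ^+ 2 / 4 <= expR (y ^+ 2 / 4) by exact: expR_ge1Dx.
  have e2 : y <= 1 + y ^+ 2 / 4.
    by have := sqr_ge0 (y / 2 - 1); lra.
  have e3 : 0 <= y ^+ 2 by exact: sqr_ge0.
  have m0 := normr_ge0 m; have s0' := normr_ge0 s.
  rewrite (le_trans h)// mulrDl lerD//.
    by rewrite ler_peMr//; lra.
  by rewrite ler_wpM2l//; lra.
have -> : (`|m| + `|s|) * normal_peak s / normal_peak s' *
    (normal_peak s' * normal_fun m s' x) =
    (`|m| + `|s|) * expR (y ^+ 2 / 4) * (normal_peak s * normal_fun m s x).
  have -> : normal_fun m s' x = expR (y ^+ 2 / 4) * normal_fun m s x.
    by rewrite /normal_fun -expRD s'2 y2; congr expR; field; rewrite s0.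
  by field; rewrite gt_eqF.
by rewrite ler_wpM2r// mulr_ge0 ?normal_peak_ge0 ?normal_fun_ge0.
Qed.

End normal_law_facts.

(** * Measurability of continuous maps for Borel sets *)

Section borel_continuous.

Lemma continuous_borel_measurable (U V : ptopologicalType) (f : U -> V) :
  continuous f -> measurable_fun setT (f : borel U -> borel V).
Proof.
move=> /continuousP cf;
  apply: (@measurability _ _ (borel U) (borel V) setT f open) => //.
by move=> _ [A oA <-]; rewrite setTI; apply: sub_sigma_algebra; exact: cf.
Qed.

Lemma continuous_borel_measurable_real (R : realType) (U : ptopologicalType)
    (f : U -> R) :
  continuous f -> measurable_fun setT (f : borel U -> R).
Proof.
move=> /continuousP cf.
apply: (measurability _ (RGenOInfty.measurableE R)) => //.
move=> _ [_ [a ->] <-]; rewrite setTI; apply: sub_sigma_algebra.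
by apply: cf; exact: interval_open.
Qed.

Lemma continuous_affine (R : realType) n (t : 'cV[R]_n) c :
  continuous (affine t c).
Proof.
have -> : affine t c = (fun y => \sum_i t i 0 * y i 0) \+ cst c.
  by apply/funext => y; rewrite /affine mxE; under eq_bigr do rewrite mxE.
move=> y; apply: continuousD; last exact: cst_continuous.
apply: continuous_big; first exact: add_continuous.
by move=> i _ z; apply: continuousM;
  [exact: cst_continuous|exact: coord_continuous].
Qed.

Lemma continuous_dsubmx (R : realType) m n p : continuous (@dsubmx R m n p).
Proof.
move=> M s /nbhs_ballP[e e0 es]; apply/nbhs_ballP; exists e => // N [_ MN].
by apply: es; split => // i j; rewrite !mxE; exact: MN.
Qed.

End borel_continuous.

(** * The cardinal sine at the origin *)

Section sinc.
Context {R : realType}.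

Lemma norm_sin_le (x : R) : `|sin x| <= `|x|.
Proof.
wlog x0 : x / 0 < x => [hwlog|].
  case: (ltgtP x 0) => [xn|/hwlog//|->]; last by rewrite sin0.
  by rewrite -normrN -sinN -[leRHS]normrN hwlog// oppr_gt0.
have [|y _] := @MVT R (@sin R) (@cos R) 0 x x0.
- by apply: continuous_subspaceT; exact: continuous_sin.
by rewrite sin0 !subr0 => ->; rewrite normrM ler_piMl// cos_max.
Qed.

(** By the mean value theorem [sin x / x] is a value of the cosine at a point
    between 0 and [x], and [1 - cos c = 2 * sin (c / 2) ^+ 2]. *)
Lemma sinc_bounds (x : R) : x != 0 -> 1 - x ^+ 2 <= sin x / x <= 1.
Proof.
have pos (y : R) : 0 < y -> 1 - y ^+ 2 <= sin y / y <= 1.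
  move=> y0; have [|c cy] := @MVT R (@sin R) (@cos R) 0 y y0.
  - by apply: continuous_subspaceT; exact: continuous_sin.
  rewrite sin0 !subr0 => ->; rewrite mulfK ?gt_eqF// cos_le1 andbT.
  move: cy; rewrite in_itv/= => /andP[c0 cy].
  have -> : cos c = 1 - 2 * sin (c / 2) ^+ 2.
    have {1}-> : c = (c / 2) *+ 2 by rewrite mulr2n; field.
    by rewrite cos_mulr2n sin2cos2 mulr2n; ring.
  have h : `|sin (c / 2)| <= c / 2.
    by rewrite (le_trans (norm_sin_le _))// ger0_norm// divr_ge0// ltW.
  have : `|sin (c / 2)| ^+ 2 <= (c / 2) ^+ 2
    by rewrite lerXn2r ?nnegrE ?(le_trans _ h).
  rewrite real_normK ?num_real// => h2.
  have : c ^+ 2 <= y ^+ 2 by rewrite lerXn2r ?nnegrE ?ltW.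
  have := sqr_ge0 y; lra.
move=> x0; case: (ltgtP x 0) => [xn|xp|x00].
- by have := pos (- x); rewrite oppr_gt0 sinN invrN mulrNN sqrrN; exact.
- exact: pos.
- by rewrite x00 eqxx in x0.
Qed.

Lemma sinc_norm_le (x : R) : `|sin x / x| <= 1.
Proof.
have [->|x0] := eqVneq x 0; first by rewrite invr0 mulr0 normr0.
by rewrite normrM normfV ler_pdivrMr ?normr_gt0// mul1r norm_sin_le.
Qed.

Lemma cvg_sinc_div (z : R) : z != 0 ->
  sin (z / k.+1%:R) / (z / k.+1%:R) @[k --> \oo] --> (1 : R).
Proof.
move=> z0; apply: (@squeeze_cvgr _ _ _ _
  (fun k => 1 - (z / k.+1%:R) ^+ 2) (fun=> 1)).
- by apply: nearW => k; apply: sinc_bounds;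
    rewrite mulf_neq0// invr_eq0 pnatr_eq0.
- rewrite -[X in _ --> X]subr0; apply: cvgB; first exact: cvg_cst.
  rewrite -[X in _ --> X](expr0n R 2) -[X in (X ^+ 2)%R](mulr0 z).
  have h : z / k.+1%:R @[k --> \oo] --> z * 0.
    by apply: cvgMl_tmp; exact: cvg_harmonic.
  by under eq_fun do rewrite expr2; rewrite expr2; apply: cvgM.
- exact: cvg_cst.
Qed.

End sinc.

(** * Symmetric residuals are orthogonal to sine waves *)

Section symmetric_law.
Context {d : measure_display} {T : measurableType d} {R : realType}.
Context (P : probability T R).

Lemma Rintegral_eq_law (U V : T -> R) (F : R -> R) (M : R) :
  measurable_fun setT U -> measurable_fun setT V -> measurable_fun setT F ->
  (forall x, `|F x| <= M) ->
  (forall D : set R, measurable D -> P (U @^-1` D) = P (V @^-1` D)) ->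
  Rintegral P setT (fun w => F (U w)) = Rintegral P setT (fun w => F (V w)).
Proof.
move=> mU mV mF FM UV.
have iF Y : measurable_fun setT Y -> P.-integrable setT (EFin \o F \o Y).
  move=> mY; apply: (@measurable_bounded_integrable _ _ _ P (F \o Y)) => //.
  - by rewrite -ge0_fin_numE// fin_num_measure.
  - exact: measurableT_comp.
  - by exists M; split; rewrite ?num_real // => x Mx y _;
      exact: (le_trans (FM _) (ltW Mx)).
have mEF : measurable_fun setT (EFin \o F) by exact/measurable_EFinP.
congr fine.
have := @integral_pushforward _ _ _ _ R U mU P setT _ mEF (iF _ mU) measurableT.
rewrite preimage_setT => <-.
have := @integral_pushforward _ _ _ _ R V mV P setT _ mEF (iF _ mV) measurableT.
rewrite preimage_setT => <-.
by apply: eq_measure_integral => A mA _; exact: UV.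
Qed.

(** Integrating the cosine against the two equal laws leaves
    [E (sin (a * Z) * sin (t^T X + c)) = 0], since the difference of the two
    cosines is twice this product.  The factor [Z] itself is the limit of
    [sin (a * Z) / a], which is dominated by [|Z|]. *)
Lemma trig_orth_symmetric_law (n : nat) (X : T -> 'cV[R]_n) (Z : T -> R) :
  (forall t c, measurable_fun setT (fun w => affine t c (X w))) ->
  P.-integrable setT (EFin \o Z) ->
  (forall (a : R) (t : 'cV[R]_n) (D : set R), measurable D ->
    P [set w | D (a * Z w + (t^T *m X w) 0 0)] =
    P [set w | D (- a * Z w + (t^T *m X w) 0 0)]) ->
  trig_orth P X Z.
Proof.
move=> mX iZ law; split=> // t c.
have mZ : measurable_fun setT Z by exact/measurable_EFinP/(measurable_int P).
have mtX : measurable_fun setT (fun w => (t^T *m X w) 0 0).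
  by have := mX t 0; congr measurable_fun; apply/funext => w;
    rewrite /affine addr0.
have msin (f : T -> R) : measurable_fun setT f ->
    measurable_fun setT (fun w => sin (f w)).
  by move=> mf; apply: measurableT_comp => //; apply: continuous_measurable_fun;
    exact: continuous_sin.
have mcos : measurable_fun setT (fun x : R => cos (x + c)).
  apply: measurableT_comp; last exact: measurable_funD.
  by apply: continuous_measurable_fun; exact: continuous_cos.
pose U a w := a * Z w + (t^T *m X w) 0 0.
have mU a : measurable_fun setT (U a).
  by apply: measurable_funD => //; exact: measurable_funM.
have iB (f : T -> R) : measurable_fun setT f -> (forall w, `|f w| <= 1) ->
    P.-integrable setT (EFin \o f).
  move=> mf f1; apply: measurable_bounded_integrable => //.
    by rewrite -ge0_fin_numE// fin_num_measure.
  by exists 1; split; rewrite ?num_real // => x Mx y _;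
    exact: (le_trans (f1 _) (ltW Mx)).
have ss a : Rintegral P setT
    (fun w => sin (a * Z w) * sin (affine t c (X w))) = 0.
  have E w : sin (a * Z w) * sin (affine t c (X w)) =
      2^-1 * (cos (U (- a) w + c) - cos (U a w + c)).
    have -> : U a w + c = a * Z w + affine t c (X w)
      by rewrite /U /affine addrA.
    have -> : U (- a) w + c = - (a * Z w) + affine t c (X w).
      by rewrite /U /affine addrA mulNr.
    by rewrite !cosD cosN sinN; field.
  have iU b : P.-integrable setT (EFin \o (fun w => cos (U b w + c))).
    by apply: iB => [|w]; [exact: (measurableT_comp mcos)|exact: cos_max].
  under eq_Rintegral do rewrite E.
  rewrite RintegralZl//;
    last exact: (integrableB measurableT (iU (- a)) (iU a)).
  rewrite RintegralB//.
  rewrite (@Rintegral_eq_law (U (- a)) (U a) (fun x => cos (x + c)) 1)//.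
  - by rewrite subrr mulr0.
  - by move=> x; exact: cos_max.
  - by move=> D mD; exact/esym/law.
have E k w : k.+1%:R * (sin (k.+1%:R^-1 * Z w) * sin (affine t c (X w))) =
    Z w * (sin (Z w / k.+1%:R) / (Z w / k.+1%:R)) * sin (affine t c (X w)).
  have [->|z0] := eqVneq (Z w) 0; first by rewrite mulr0 sin0 !(mul0r, mulr0).
  by rewrite [k.+1%:R^-1 * _]mulrC; field; rewrite z0 nat1r pnatr_eq0.
have msZ k : measurable_fun setT (fun w => sin (k.+1%:R^-1 * Z w)).
  by apply: msin; exact: measurable_funM.
have := @cvg_Rintegral_dominated _ _ _ P
  (fun k w => k.+1%:R * (sin (k.+1%:R^-1 * Z w) * sin (affine t c (X w))))
  (fun w => Z w * sin (affine t c (X w))) (fun w => `|Z w|).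
rewrite (_ : (fun k => Rintegral _ _ _) = fun=> 0); last first.
  apply/funext => k; rewrite RintegralZl ?ss ?mulr0//; apply: iB.
    by apply: measurable_funM; [exact: msZ|exact: msin].
  by move=> w; rewrite normrM mulr_ile1// sin_max.
move=> h; rewrite -[LHS](cvg_lim _ (h _ _ _ _)) ?lim_cst//.
- move=> k; apply: measurable_funM => //.
  by apply: measurable_funM; [exact: msZ|exact: msin].
- exact: integrable_norm.
- move=> k w; rewrite E !normrM -mulrA ler_piMr// mulr_ile1// ?sin_max//.
  by rewrite -normrM sinc_norm_le.
- move=> w; under eq_fun do rewrite E.
  apply: cvgMr_tmp; have [->|z0] := eqVneq (Z w) 0.
    by under eq_fun do rewrite mul0r; exact: cvg_cst.
  by rewrite -[X in _ --> X]mulr1; apply: cvgMl_tmp; exact: cvg_sinc_div.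
Qed.

End symmetric_law.

(** * Positive semidefinite block matrices *)

Section block_quadratic_form.
Context {R : realType} (n : nat) (v : R) (b : 'cV[R]_n) (A : 'M[R]_n).

Let Sigma : 'M[R]_(1 + n) := block_mx v%:M b^T b A.

Lemma block_linear_formE (a x : R) (u y : 'cV[R]_n) :
  ((col_mx a%:M u : 'cV_(1 + n))^T *m col_mx x%:M y) 0 0 =
  a * x + (u^T *m y) 0 0.
Proof.
rewrite tr_col_mx mul_row_col tr_scalar_mx -scalar_mxM mxE.
by congr (_ + _); rewrite mxE eqxx mulr1n.
Qed.

Lemma block_quadratic_formE (a : R) (u : 'cV[R]_n) :
  ((col_mx a%:M u : 'cV_(1 + n))^T *m Sigma *m col_mx a%:M u) 0 0 =
  a ^+ 2 * v + a * (b^T *m u) 0 0 *+ 2 + (u^T *m A *m u) 0 0.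
Proof.
have ub : (u^T *m b) 0 0 = (b^T *m u) 0 0.
  by rewrite -[in RHS](trmxK u) -trmx_mul [in RHS]mxE.
rewrite tr_col_mx mul_row_block mul_row_col tr_scalar_mx.
have addE (M N : 'M[R]_1) : (M + N) 0 0 = M 0 0 + N 0 0 by rewrite mxE.
have sclE k (M : 'M[R]_1) : (k *: M) 0 0 = k * M 0 0 by rewrite mxE.
have vE : (v%:M : 'M[R]_1) 0 0 = v by rewrite mxE eqxx mulr1n.
rewrite !mul_scalar_mx !mul_mx_scalar mulmxDl.
rewrite -scalemxAl !(addE, sclE, vE) ub; ring.
Qed.

Context (Sigma_ge0 :
  forall s : 'cV[R]_(1 + n), 0 <= (s^T *m Sigma *m s) 0 0).

(** Since [A w = 0], the quadratic form at [(a, r w)] is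
    [a ^+ 2 * v + 2 * a * r * (b^T w)], which takes negative values unless
    [b^T w = 0]. *)
Lemma psd_cross_covariance (w : 'cV[R]_n) : A *m w = 0 -> b^T *m w = 0.
Proof.
move=> Aw; set beta := (b^T *m w) 0 0.
have q a r : 0 <= a ^+ 2 * v + a * (r * beta) *+ 2.
  have := Sigma_ge0 (col_mx a%:M (r *: w)).
  rewrite block_quadratic_formE -!scalemxAr -mulmxA Aw mulmx0 scaler0.
  by rewrite [X in _ + X]mxE addr0 [X in a * X]mxE.
have v0 : 0 <= v by have := q 1 0;
  rewrite !mul0r mulr0 mul0rn addr0 expr1n mul1r.
(* The form at this point is [- beta ^+ 2 * (v + 2)]. *)
have := q (- beta) (v + 1) => h.
have beta0 : beta ^+ 2 = 0.
  apply/eqP; rewrite eq_le sqr_ge0 andbT.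
  have : beta ^+ 2 * (v + 2) <= 0 by rewrite mulr2n in h; lra.
  by rewrite pmulr_lle0//; lra.
apply/matrixP => i j; rewrite !ord1 -/beta mxE.
by move/eqP: beta0; rewrite sqrf_eq0 => /eqP.
Qed.

(** The columns of [1%:M - mp_inverse A *m A] lie in the kernel of [A]. *)
Lemma psd_cross_covariance_mp : b^T *m mp_inverse A *m A = b^T.
Proof.
have [AXA _ _ _] := mp_inverseP A; set X := mp_inverse A in AXA *.
apply/eqP; rewrite -subr_eq0; apply/eqP/matrixP => i j; rewrite !ord1.
have E : b^T *m X *m A - b^T = - (b^T *m (1%:M - X *m A)).
  by rewrite mulmxBr mulmx1 mulmxA opprB.
have := @psd_cross_covariance ((1%:M - X *m A) *m delta_mx j 0).
rewrite !mulmxA mulmxBr mulmx1 mulmxA AXA subrr mul0mx => /(_ erefl).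
by rewrite E -colE => /matrixP/(_ 0 0); rewrite !mxE => ->; rewrite oppr0.
Qed.

End block_quadratic_form.

(** * Conditioning of jointly normal vectors *)

Section normal_conditioning.
Context {d : measure_display} {T : measurableType d} {R : realType}.
Context (P : probability T R).

Lemma integrable_normal_law (Y : T -> R) (m s : R) :
  measurable_fun setT Y ->
  (forall D : set R, measurable D -> P [set w | D (Y w)] = normal_law m s D) ->
  P.-integrable setT (EFin \o Y).
Proof.
move=> mY law; apply/integrableP; split; first exact/measurable_EFinP.
pose Y' : T -> measurableTypeR R := Y.
have mabs : measurable_fun setT (fun x : measurableTypeR R => `|x%:E|%E).
  exact: measurableT_comp.
have := @ge0_integral_pushforward _ _ _ _ R Y' mY P setT _ measurableT mabs
  (fun x _ => abse_ge0 _).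
rewrite preimage_setT /= => <-.
have [s0|s0] := eqVneq s 0.
  rewrite (eq_measure_integral (dirac (m : measurableTypeR R))); last first.
    by move=> D mD _; rewrite /= /pushforward [LHS]law// /normal_law s0 eqxx.
  by rewrite integral_dirac// diracT mul1e ltry.
apply: le_lt_trans (normal_prob_first_moment m s0).
rewrite le_eqVlt; apply/orP; left; apply/eqP;
  apply: eq_measure_integral => D mD _.
by rewrite /= /pushforward [LHS]law// /normal_law (negbTE s0).
Qed.

(** The coefficient vector [V] of the regression satisfies [V^T A = b^T], which
    cancels the mixed term in the variance of [a * Z + t^T X], where [Z]
    is the residual, and thus makes that variance even in [a]. *)
Theorem mvnormal_cond_mean (n : nat) (Y : T -> R) (X : T -> 'cV[R]_n)
    (mY v : R) (mX b : 'cV[R]_n) (A : 'M[R]_n) :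
  mvnormal P (fun w => col_mx (Y w)%:M (X w) : 'cV[R]_(1 + n))
    (col_mx mY%:M mX) (block_mx v%:M b^T b A) ->
  cond_mean_version P Y X
    (fun z => mY + (b^T *m mp_inverse A *m (z - mX)) 0 0).
Proof.
move=> [mJ SigmaT Sigma_ge0 law].
have AT : A^T = A by move: SigmaT; rewrite tr_block_mx => /eq_block_mx[].
have lawE a (u : 'cV[R]_n) (D : set R) : measurable D ->
    P [set w | D (a * Y w + (u^T *m X w) 0 0)] =
    normal_law (a * mY + (u^T *m mX) 0 0) (Num.sqrt
      (a ^+ 2 * v + a * (b^T *m u) 0 0 *+ 2 + (u^T *m A *m u) 0 0)) D.
  move=> mD; rewrite -block_quadratic_formE -block_linear_formE -law//.
  by congr (P _); apply/seteqP; split => w /=; rewrite block_linear_formE.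
have mlin a (u : 'cV[R]_n) c :
    measurable_fun setT (fun w => a * Y w + (u^T *m X w) 0 0 + c).
  have := measurableT_comp
    (continuous_borel_measurable_real
      (@continuous_affine R (1 + n) (col_mx a%:M u) c)) mJ.
  by congr measurable_fun; apply/funext => w;
    rewrite /= /affine block_linear_formE.
have mXb : measurable_fun setT (X : T -> borel 'cV[R]_n).
  have := measurableT_comp
    (continuous_borel_measurable (@continuous_dsubmx R 1 n 1)) mJ.
  by congr measurable_fun; apply/funext => w; rewrite /= col_mxKd.
have mA t c : measurable_fun setT (fun w => affine t c (X w)).
  by have := mlin 0 t c; congr measurable_fun; apply/funext => w;
    rewrite mul0r add0r.
have ilin a (u : 'cV[R]_n) c :
    P.-integrable setT (EFin \o (fun w => a * Y w + (u^T *m X w) 0 0 + c)).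
  have i1 : P.-integrable setT (EFin \o (fun w => a * Y w + (u^T *m X w) 0 0)).
    apply: (integrable_normal_law _ (lawE a u)).
    by have := mlin a u 0; congr measurable_fun; apply/funext => w;
      rewrite addr0.
  have i2 : P.-integrable setT (EFin \o (fun=> c))
    by exact: finite_measure_integrable_cst.
  exact: (integrableD measurableT i1 i2).
set V := (b^T *m mp_inverse A)^T.
have VA : V^T *m A = b^T by rewrite trmxK (psd_cross_covariance_mp Sigma_ge0).
set g := fun z => _.
have gE z : g z = (V^T *m z) 0 0 + (mY - (V^T *m mX) 0 0).
  by rewrite /g mulmxBr !mxE /V trmxK; ring.
have iY : P.-integrable setT (EFin \o Y).
  have := ilin 1 0 0; congr (integrable P setT (EFin \o _)).
  by apply/funext => w; rewrite trmx0 mul0mx mxE mul1r !addr0.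
have ig : P.-integrable setT (EFin \o (g \o X)).
  have := ilin 0 V (mY - (V^T *m mX) 0 0);
    congr (integrable P setT (EFin \o _)).
  by apply/funext => w; rewrite mul0r add0r /= gE.
have Zo : trig_orth P X (fun w => Y w - g (X w)).
  apply: trig_orth_symmetric_law => //;
    first exact: (integrableB measurableT iY ig).
  move=> a t D mD.
  have H a' : P [set w | D (a' * (Y w - g (X w)) + (t^T *m X w) 0 0)] =
    normal_law ((t^T *m mX) 0 0)
      (Num.sqrt (a' ^+ 2 * (v - (b^T *m V) 0 0) + (t^T *m A *m t) 0 0)) D.
    (* [a' * Z + t^T X] is a linear form in [(Y, X)] plus the constant [c]. *)
    pose c := a' * ((V^T *m mX) 0 0 - mY).
    have uE y : ((t - a' *: V)^T *m y) 0 0 =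
        (t^T *m y) 0 0 - a' * (V^T *m y) 0 0.
      rewrite (_ : (t - a' *: V)^T = t^T - a' *: V^T).
        by rewrite mulmxBl -scalemxAl [LHS]mxE [X in _ + X]mxE [X in _ - X]mxE.
      by apply/matrixP => i j; rewrite !mxE.
    have := lawE a' (t - a' *: V) ((fun x => x + c) @^-1` D).
    rewrite normal_law_shift//.
    have -> : a' * mY + ((t - a' *: V)^T *m mX) 0 0 + c = (t^T *m mX) 0 0.
      by rewrite uE /c; ring.
    have -> : a' ^+ 2 * v + a' * (b^T *m (t - a' *: V)) 0 0 *+ 2 +
        ((t - a' *: V)^T *m A *m (t - a' *: V)) 0 0 =
        a' ^+ 2 * (v - (b^T *m V) 0 0) + (t^T *m A *m t) 0 0.
      rewrite -mulmxA uE !mulmxA VA.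
      have bE : (b^T *m (t - a' *: V)) 0 0 =
          (b^T *m t) 0 0 - a' * (b^T *m V) 0 0.
        by rewrite mulmxBr -scalemxAr [LHS]mxE [X in _ + X]mxE [X in _ - X]mxE.
      rewrite bE mulmxBr -scalemxAr [X in _ + (X - _)]mxE.
      rewrite [X in _ + (_ + X - _)]mxE [X in _ + (_ - X - _)]mxE.
      have -> : (t^T *m A *m V) 0 0 = (b^T *m t) 0 0.
        rewrite -[in LHS](trmxK (t^T *m A *m V)) [LHS]mxE !trmx_mul (trmxK t).
        by rewrite AT mulmxA VA.
      by rewrite mulr2n; ring.
    move=> <-; last first.
      by rewrite -[X in measurable X]setTI; exact: measurable_funD.
    congr (P _); apply/seteqP; split => w /=;
      suff -> : a' * (Y w - g (X w)) + (t^T *m X w) 0 0 =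
        a' * Y w + ((t - a' *: V)^T *m X w) 0 0 + c by [];
      by rewrite uE gE /c; ring.
  by rewrite !H sqrrN.
split => //.
- have := measurableT_comp (continuous_borel_measurable_real
    (@continuous_affine R n V (mY - (V^T *m mX) 0 0)))
    (@measurable_id _ (borel 'cV[R]_n) setT).
  by congr measurable_fun; apply/funext => z; rewrite gE.
- move=> D mD; have := trig_orth_integral_eq0 mXb mA Zo mD.
  have mXD : measurable (X @^-1` D).
    by rewrite -[X in measurable X]setTI; exact: mXb.
  have iS f : P.-integrable setT (EFin \o f) ->
      P.-integrable (X @^-1` D) (EFin \o f).
    by move=> h; apply: (integrableS measurableT).
  rewrite integralB_EFin//; [|exact: iS..].
  move/eqP; rewrite sube_eq ?fin_num_adde_defr// ?add0e; first by move/eqP.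
  by apply: integrable_fin_num => //; exact: iS.
Qed.

End normal_conditioning.

(** * The kernel-based estimator *)

Lemma borel_measurable_set1 (R : realType) n (z : 'cV[R]_n) :
  measurable ([set z] : set (borel 'cV[R]_n)).
Proof.
rewrite -[[set z]]setCK; apply: measurableC; apply: sub_sigma_algebra.
rewrite openC; apply: accessible_closed_set1.
by apply: hausdorff_accessible; exact: norm_hausdorff.
Qed.

(* Null events cannot be conditioned on directly: the formula is a version of
   the conditional mean function z |-> E(L | L_n = z), whose value at z = f_n
   is the estimator; it is the elementary conditional mean if P(A_n) > 0. *)
Theorem theorem3p4 (R : realType) (B : completeNormedModType R)
    (P : probability (borel B) R) (mu : B) (K : dual B -> dual B -> R)
    (hP : kernel_based P mu K) (u : B) (n : nat) (Ls : 'I_n -> dual B)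
    (hA : cov_mx K Ls != 0) (L : dual B) :
  let f_n := Lvec Ls u in
  let A_n : set (borel B) := [set w | Lvec Ls w = f_n] in
  let s (z : 'cV[R]_n) : R := pairing mu L +
    ((cov_vec K Ls L)^T *m mp_inverse (cov_mx K Ls) *m (z - Lvec Ls mu)) 0 0 in
  cond_mean_version P (S_ L) (Lvec Ls) s /\
  ((0 < P A_n)%E -> cond_estimator P A_n L = s f_n).
Proof.
move=> f_n A_n s.
(* The joint vector [(L, L_1, ..., L_n)] is again a list of functionals. *)
pose Ls1 (i : 'I_(1 + n)) := if fintype.split i is inr j then Ls j else L.
have Ls1l i : Ls1 (lshift n i) = L by rewrite /Ls1 (unsplitK (inl i)).
have Ls1r j : Ls1 (rshift 1 j) = Ls j by rewrite /Ls1 (unsplitK (inr j)).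
(* Covariance matrices are symmetric, hence so is the kernel. *)
have KC : forall j, K (Ls j) L = K L (Ls j).
  have [_ /matrixP KT _ _] := hP _ Ls1.
  by move=> j; have := KT (lshift n 0) (rshift 1 j); rewrite !mxE Ls1l Ls1r.
have hv : cond_mean_version P (S_ L) (Lvec Ls) s.
  apply: (@mvnormal_cond_mean _ _ _ P n (S_ L) (Lvec Ls) _ (K L L)).
  have := hP _ Ls1; congr mvnormal.
  - apply/funext => w; rewrite -[LHS]vsubmxK; congr col_mx.
      by apply/matrixP => i j; rewrite !ord1 !mxE Ls1l eqxx mulr1n.
    by apply/matrixP => i j; rewrite !mxE Ls1r.
  - rewrite -[LHS]vsubmxK; congr col_mx.
      by apply/matrixP => i j; rewrite !ord1 !mxE Ls1l eqxx mulr1n.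
    by apply/matrixP => i j; rewrite !mxE Ls1r.
  - rewrite -[LHS]submxK; congr block_mx; apply/matrixP => i j.
    + by rewrite !ord1 !mxE !Ls1l eqxx mulr1n.
    + by rewrite !mxE Ls1l Ls1r.
    + by rewrite !mxE Ls1l Ls1r KC.
    + by rewrite !mxE !Ls1r.
split=> // PA.
have [_ _ _ /(_ [set f_n] (@borel_measurable_set1 R n f_n))] := hv.
have AE : Lvec Ls @^-1` [set f_n] = A_n by [].
rewrite AE => E; rewrite /cond_estimator /Rintegral E.
have mA : measurable A_n.
  have [mX _ _ _] := hP _ Ls.
  by rewrite -AE -[X in measurable X]setTI; apply: mX => //;
    exact: borel_measurable_set1.
rewrite (eq_integral (fun=> (s f_n)%:E)); last first.
  by move=> w; rewrite inE /A_n /= => ->.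
rewrite integral_cst// fineM ?fin_num_measure//= mulfK//.
by rewrite fine_eq0 ?fin_num_measure// gt_eqF.
Qed.
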